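(* Let $\mathcal{R}$ be a $2$-torsion free commutative ring with unity and let $X$ be a connected locally finite pre-ordered set. Then every Lie triple derivation $L$ of the incidence algebra $I(X,\mathcal{R})$ is proper; that is, there exist a derivation $D$ of $I(X,\mathcal{R})$ and an $\mathcal{R}$-linear map $F: I(X,\mathcal{R})\to I(X,\mathcal{R})$ with image contained in the centre of $I(X,\mathcal{R})$ such that $L=D+F$.
   Context: A pre-ordered set $(X,\leqslant)$ is a set with a reflexive and transitive relation; it is locally finite if for all $x\leqslant y$ there are only finitely many $z\in X$ with $x\leqslant z\leqslant y$. $X$ is connected if any two elements of $X$ can be joined by a finite sequence of elements of $X$ in which consecutive elements are comparable (i.e. $u\leqslant v$ or $v\leqslant u$). The incidence algebra is $I(X,\mathcal{R})=\{f:X\times X\to\mathcal{R}\mid f(x,y)=0 \text{ if } x\not\leqslant y\}$, with pointwise addition and scalar multiplication and product $(fg)(x,y)=\sum_{x\leqslant z\leqslant y}f(x,z)g(z,y)$ for $x\leqslant y$. $\mathcal{R}$ is $2$-torsion free if $2r=0$ implies $r=0$ for $r\in\mathcal{R}$. For an associative $\mathcal{R}$-algebra $A$, write $[x,y]=xy-yx$. A derivation of $A$ is an $\mathcal{R}$-linear map $D:A\to A$ with $D(xy)=D(x)y+xD(y)$. A Lie triple derivation of $A$ is an $\mathcal{R}$-linear map $L:A\to A$ with $L([[x,y],z])=[[L(x),y],z]+[[x,L(y)],z]+[[x,y],L(z)]$ for all $x,y,z\in A$. *)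

(* Defs.v *)
From HB Require Import structures.
From mathcomp Require Import all_boot all_order all_algebra.
From mathcomp Require Import boolp classical_sets functions cardinality fsbigop.

Set Implicit Arguments.
Unset Strict Implicit.
Unset Printing Implicit Defensive.

Import Order.TTheory GRing.Theory.

Local Open Scope classical_set_scope.
Local Open Scope ring_scope.

HB.mixin Record isLocallyFinite d X of Order.Preorder d X := {
  finite_between : forall x y : X, finite_set [set z : X | (x <= z <= y)%O]
}.

#[short(type="locallyFinitePreorderType")]
HB.structure Definition LocallyFinitePreorder (d : Order.disp_t) :=
  { X of Order.Preorder d X & isLocallyFinite d X }.

Definition connected_preorder (d : Order.disp_t) (X : preorderType d) : Prop :=
  forall x y : X, exists s : seq X,
    path (fun u v : X => (u >=< v)%O) x s /\ last x s = y.

Definition two_torsion_free (R : pzRingType) : Prop :=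
  forall r : R, r *+ 2 = 0 -> r = 0.

Section RingNotions.
Variable A : pzRingType.

Definition lie_bracket (a b : A) : A := a * b - b * a.

Definition is_derivation (D : A -> A) : Prop :=
  forall a b : A, D (a * b) = D a * b + a * D b.

Definition is_lie_triple_derivation (L : A -> A) : Prop :=
  forall a b c : A,
    L (lie_bracket (lie_bracket a b) c) =
      lie_bracket (lie_bracket (L a) b) c
      + lie_bracket (lie_bracket a (L b)) c
      + lie_bracket (lie_bracket a b) (L c).

Definition is_central (z : A) : Prop := forall a : A, GRing.comm z a.

End RingNotions.

Section IncidenceAlgebra.
Variables (R : comPzRingType) (d : Order.disp_t).
Variable X : locallyFinitePreorderType d.

Definition incidence_supp : {pred X -> X -> R} :=
  fun f => `[< forall x y : X, ~~ (x <= y)%O -> f x y = 0 >].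

Fact incidence_zmod_closed : zmod_closed incidence_supp.
Proof.
split=> [|f g /asboolP f0 /asboolP g0]; apply/asboolP=> x y xy //.
by rewrite !fctE f0 ?g0 ?subr0.
Qed.

HB.instance Definition _ :=
  GRing.isZmodClosed.Build (X -> X -> R) incidence_supp incidence_zmod_closed.

Record incidence := Incidence {
  incidence_fun :> X -> X -> R;
  _ : incidence_fun \in incidence_supp
}.

HB.instance Definition _ := [isSub for incidence_fun].
HB.instance Definition _ := [Choice of incidence by <:].
HB.instance Definition _ := [SubChoice_isSubZmodule of incidence by <:].

Implicit Types (f g h : incidence) (x y z : X) (c : R).

Lemma incidence_out f x y : ~~ (x <= y)%O -> f x y = 0.
Proof. by case: f => f /= /asboolP; exact. Qed.

Lemma incidenceP f g : (forall x y, f x y = g x y) -> f = g.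
Proof. by move=> fg; apply/val_inj/funext=> x; apply/funext=> y; exact: fg. Qed.

Definition between x y : set X := [set z | (x <= z <= y)%O].

(* The sum is 0 when x <= y fails, since [between x y] is then empty. *)
Definition convolution f g x y : R := \sum_(z \in between x y) f x z * g z y.

Fact convolution_supp f g : convolution f g \in incidence_supp.
Proof.
apply/asboolP=> x y xy; rewrite /convolution fsbig1// => z /andP[xz zy].
by rewrite (le_trans xz zy) in xy.
Qed.

Definition incidence_mul f g : incidence := Incidence (convolution_supp f g).

Fact kronecker_supp : (fun x y => (x == y)%:R : R) \in incidence_supp.
Proof. by apply/asboolP=> x y; case: eqVneq => [->|//]; rewrite lexx. Qed.

Definition incidence_one : incidence := Incidence kronecker_supp.

Fact scale_supp c f : (fun x y => c * f x y) \in incidence_supp.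
Proof. by apply/asboolP=> x y xy; rewrite incidence_out// mulr0. Qed.

Definition incidence_scale c f : incidence := Incidence (scale_supp c f).

Fact incidence_mulA : associative incidence_mul.
Proof.
move=> f g h; apply: incidenceP => x y /=; rewrite /convolution.
pose S := between x y.
have Sfin : finite_set S by exact: finite_between.
have lhs z : z \in S -> f x z * incidence_mul g h z y =
    \sum_(w \in S) f x z * (g z w * h w y).
  move=> /set_mem /andP[xz zy] /=; rewrite /convolution.
  rewrite (@fsbig_widen _ _ 0 +%R (between z y) S) /=.
  - by rewrite !fsbig_finite// mulr_sumr.
  - by move=> w /andP[zw wy]; rewrite /S/between/= (le_trans xz zw).
  - move=> w [/andP[_ wy] /negP]; rewrite wy andbT => zw.
    by rewrite /preimage/= (@incidence_out g) ?mul0r ?mulr0.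
have rhs w : w \in S -> incidence_mul f g x w * h w y =
    \sum_(z \in S) f x z * (g z w * h w y).
  move=> /set_mem /andP[xw wy] /=; rewrite /convolution.
  rewrite (@fsbig_widen _ _ 0 +%R (between x w) S) /=.
  - rewrite !fsbig_finite// mulr_suml.
    by apply: eq_bigr => z _; rewrite mulrA.
  - by move=> z /andP[xz zw]; rewrite /S/between/= xz (le_trans zw wy).
  - move=> z [/andP[xz _] /negP]; rewrite xz /= => zw.
    by rewrite /preimage/= (@incidence_out g) ?mulr0.
by rewrite (eq_fsbigr _ _ lhs) (eq_fsbigr _ _ rhs) exchange_fsbig.
Qed.

Fact incidence_mul1r : left_id incidence_one incidence_mul.
Proof.
move=> f; apply: incidenceP => x y /=; rewrite /convolution.
have [xy|xy] := boolP (x <= y)%O; last first.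
  rewrite incidence_out// fsbig1// => z /andP[xz zy].
  by rewrite (le_trans xz zy) in xy.
rewrite (fsbigD1 x) /=; first last.
- by rewrite /between/= lexx.
- by apply: sub_finite_set (finite_between x y) => z [].
rewrite eqxx mul1r fsbig1 ?addr0// => z [_ /eqP]; rewrite eq_sym => /negPf ->.
by rewrite mul0r.
Qed.

Fact incidence_mulr1 : right_id incidence_one incidence_mul.
Proof.
move=> f; apply: incidenceP => x y /=; rewrite /convolution.
have [xy|xy] := boolP (x <= y)%O; last first.
  rewrite incidence_out// fsbig1// => z /andP[xz zy].
  by rewrite (le_trans xz zy) in xy.
rewrite (fsbigD1 y) /=; first last.
- by rewrite /between/= lexx andbT.
- by apply: sub_finite_set (finite_between x y) => z [].
rewrite eqxx mulr1 fsbig1 ?addr0// => z [_ /eqP] /negPf ->.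
by rewrite mulr0.
Qed.

Fact incidence_mulDl : left_distributive incidence_mul +%R.
Proof.
move=> f g h; apply: incidenceP => x y /=.
rewrite /convolution !fctE /= /convolution -fsbig_split; last exact: finite_between.
by apply: eq_fsbigr => z _; rewrite mulrDl.
Qed.

Fact incidence_mulDr : right_distributive incidence_mul +%R.
Proof.
move=> f g h; apply: incidenceP => x y /=.
rewrite /convolution !fctE /= /convolution -fsbig_split; last exact: finite_between.
by apply: eq_fsbigr => z _; rewrite mulrDr.
Qed.

HB.instance Definition _ := GRing.Zmodule_isPzRing.Build incidence
  incidence_mulA incidence_mul1r incidence_mulr1
  incidence_mulDl incidence_mulDr.

Fact incidence_scaleA a b f :
  incidence_scale a (incidence_scale b f) = incidence_scale (a * b) f.
Proof. by apply: incidenceP => x y /=; rewrite mulrA. Qed.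

Fact incidence_scale1 : left_id 1 incidence_scale.
Proof. by move=> f; apply: incidenceP => x y /=; rewrite mul1r. Qed.

Fact incidence_scaleDr : right_distributive incidence_scale +%R.
Proof. by move=> c f g; apply: incidenceP => x y /=; rewrite !fctE /= mulrDr. Qed.

Fact incidence_scaleDl f : {morph incidence_scale^~ f : a b / a + b}.
Proof. by move=> a b; apply: incidenceP => x y /=; rewrite !fctE /= mulrDl. Qed.

HB.instance Definition _ := GRing.Zmodule_isLmodule.Build R incidence
  incidence_scaleA incidence_scale1 incidence_scaleDr incidence_scaleDl.

Lemma incidence0E x y : (0 : incidence) x y = 0. Proof. by []. Qed.

Lemma incidenceDE f g x y : (f + g) x y = f x y + g x y. Proof. by []. Qed.

Lemma incidenceNE f x y : (- f) x y = - f x y. Proof. by []. Qed.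

Lemma incidenceZE c f x y : (c *: f) x y = c * f x y. Proof. by []. Qed.

Lemma incidence1E x y : (1 : incidence) x y = (x == y)%:R. Proof. by []. Qed.

Lemma incidenceME f g x y :
  (f * g) x y = \sum_(z \in [set z | (x <= z <= y)%O]) f x z * g z y.
Proof. by []. Qed.

(* MathComp's [algType] excludes the zero ring, which arises here when [R] is
   zero or [X] is empty, so the algebra axioms are given as lemmas. *)
Lemma incidence_scalerAl c f g : c *: (f * g) = (c *: f) * g.
Proof.
apply: incidenceP => x y; rewrite incidenceZE !incidenceME.
rewrite !fsbig_finite; try exact: finite_between.
by rewrite mulr_sumr; apply: eq_bigr => z _; rewrite mulrA.
Qed.

Lemma incidence_scalerAr c f g : c *: (f * g) = f * (c *: g).
Proof.
apply: incidenceP => x y; rewrite incidenceZE !incidenceME.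
rewrite !fsbig_finite; try exact: finite_between.
by rewrite mulr_sumr; apply: eq_bigr => z _; rewrite mulrCA.
Qed.

End IncidenceAlgebra.

(* Main.v *)
(* Let e_xy be the matrix units and e_x = e_xx. Applying L to [[e_x, e_y], f] = 0
   shows that [L e_x, e_y] + [e_x, L e_y] is central, hence diagonal; therefore
   g(x,y) = (L e_x)(x,y), for x <> y, defines an inner derivation such that
   L' = L - [., g] maps every e_x to a diagonal element. The bracket
   [[e_x, f], e_y] = f(x,y) e_xy + f(y,x) e_yx is finitely supported even though
   f is not, and it yields (L'f)(x,y) = w(x,y) f(x,y) for x <> y. The bracket
   [[f, e_xy], e_y] gives (L'f)(x,x) = (L'f)(y,y) for x <= y, and two further
   brackets of matrix units give w(x,z) = w(x,y) + w(y,z). So f |-> w f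
   (entrywise) is a derivation, and L' differs from it by a map whose values are
   scalar diagonal elements, which are central. *)
Require Import Defs.
From HB Require Import structures.
From mathcomp Require Import all_boot all_order all_algebra.
From mathcomp Require Import boolp classical_sets functions cardinality fsbigop.
From mathcomp Require Import ring.

Set Implicit Arguments.
Unset Strict Implicit.
Unset Printing Implicit Defensive.

Import Order.TTheory GRing.Theory.

Local Open Scope ring_scope.

(** * Brackets, derivations and Lie triple derivations of a ring *)

Section RingFacts.
Variable A : pzRingType.
Implicit Types (a b c g : A).

Lemma lie_bracketDl a b c :
  lie_bracket (a + b) c = lie_bracket a c + lie_bracket b c.
Proof. by rewrite /lie_bracket mulrDl mulrDr opprD addrACA. Qed.

Lemma lie_bracketBl a b c :
  lie_bracket (a - b) c = lie_bracket a c - lie_bracket b c.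
Proof. by rewrite /lie_bracket mulrBl mulrBr !opprD !opprK addrACA. Qed.

Lemma lie_bracketBr a b c :
  lie_bracket a (b - c) = lie_bracket a b - lie_bracket a c.
Proof. by rewrite /lie_bracket mulrBl mulrBr !opprD !opprK addrACA. Qed.

Lemma is_derivation_inner g : is_derivation (fun a => lie_bracket a g).
Proof.
by move=> a b; rewrite /lie_bracket mulrBl mulrBr !mulrA [RHS]addrC addrA subrK.
Qed.

Lemma is_derivationD (D1 D2 : A -> A) :
  is_derivation D1 -> is_derivation D2 -> is_derivation (D1 \+ D2).
Proof. by move=> d1 d2 a b /=; rewrite d1 d2 addrACA mulrDl mulrDr. Qed.

Lemma derivation_lie_bracket (D : {additive A -> A}) a b : is_derivation D ->
  D (lie_bracket a b) = lie_bracket (D a) b + lie_bracket a (D b).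
Proof.
move=> dD; rewrite /lie_bracket raddfB !dD [D b * a + _]addrC opprD.
by rewrite addrACA.
Qed.

Lemma derivation_lie_triple (D : {additive A -> A}) :
  is_derivation D -> is_lie_triple_derivation D.
Proof.
by move=> dD a b c; rewrite !derivation_lie_bracket// lie_bracketDl.
Qed.

Lemma is_lie_triple_derivationB (L M : A -> A) :
  is_lie_triple_derivation L -> is_lie_triple_derivation M ->
  is_lie_triple_derivation (L \- M).
Proof.
move=> dL dM a b c /=; rewrite dL dM.
rewrite (lie_bracketBl (L a) (M a)) (lie_bracketBr _ (L b) (M b)).
rewrite (lie_bracketBl _ _ c) (lie_bracketBl (lie_bracket a _)).
rewrite (lie_bracketBr _ (L c)) opprD addrACA; congr (_ + _).
by rewrite opprD addrACA.
Qed.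

End RingFacts.

(** * Matrix units and commutators *)

Section MatrixUnitSupport.
Variables (R : comPzRingType) (d : Order.disp_t).
Variables (X : locallyFinitePreorderType d) (x y : X).

Fact matrix_unit_supp :
  (fun u v => ((x <= y)%O && (u == x) && (v == y))%:R)
    \in @incidence_supp R d X.
Proof.
apply/asboolP=> u v uv; case: (boolP (x <= y)%O) => //= xy.
case: eqVneq => //= ux; case: eqVneq => //= vy.
by rewrite ux vy xy in uv.
Qed.

End MatrixUnitSupport.

(* Junk value: [matrix_unit x y] is 0 unless [x <= y]. *)
HB.lock Definition matrix_unit (R : comPzRingType) (d : Order.disp_t)
    (X : locallyFinitePreorderType d) (x y : X) : incidence R X :=
  Incidence (matrix_unit_supp R x y).

(* A locked copy of [lie_bracket]: otherwise unification unfolds brackets down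
   to convolution sums when rewriting with the entry formulas below. *)
HB.lock Definition commutator (R : comPzRingType) (d : Order.disp_t)
    (X : locallyFinitePreorderType d) (f g : incidence R X) : incidence R X :=
  lie_bracket f g.

(** * Entry formulas; inner derivations and entrywise multiplication *)

Section IncidenceEntries.
Variables (R : comPzRingType) (d : Order.disp_t).
Variable X : locallyFinitePreorderType d.
Implicit Types (f g h : incidence R X) (x y z u v : X).
Notation E := (@matrix_unit R d X).

Lemma matrix_unitE x y u v :
  E x y u v = ((x <= y)%O && (u == x) && (v == y))%:R.
Proof. by rewrite unlock. Qed.

Lemma mul_matrix_unitr f x y u v :
  (f * E x y) u v = if (x <= y)%O && (v == y) then f u x else 0.
Proof.
rewrite incidenceME; have [/andP[xy /eqP ->]|nxy] := ifPn; last first.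
  rewrite fsbig1// => z _; rewrite matrix_unitE.
  by rewrite andbAC (negPf nxy) mulr0.
have [ux|ux] := boolP (u <= x)%O; last first.
  rewrite incidence_out// fsbig1// => z _; rewrite matrix_unitE.
  case: (eqVneq z x) => [->|_]; last by rewrite andbF mulr0.
  by rewrite incidence_out ?mul0r.
rewrite (fsbigD1 x) /=; first last.
- by rewrite ux xy.
- by apply: sub_finite_set (finite_between u y) => z [].
rewrite matrix_unitE xy !eqxx mulr1 fsbig1 ?addr0// => z [_ /eqP /negPf zE].
by rewrite matrix_unitE zE andbF mulr0.
Qed.

Lemma mul_matrix_unitl f x y u v :
  (E x y * f) u v = if (x <= y)%O && (u == x) then f y v else 0.
Proof.
rewrite incidenceME; have [/andP[xy /eqP ->]|nxy] := ifPn; last first.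
  by rewrite fsbig1// => z _; rewrite matrix_unitE (negPf nxy) mul0r.
have [yv|yv] := boolP (y <= v)%O; last first.
  rewrite incidence_out// fsbig1// => z _; rewrite matrix_unitE.
  case: (eqVneq z y) => [->|_]; last by rewrite andbF mul0r.
  by rewrite [f y v]incidence_out ?mulr0.
rewrite (fsbigD1 y) /=; first last.
- by rewrite yv xy.
- by apply: sub_finite_set (finite_between x v) => z [].
rewrite matrix_unitE xy !eqxx mul1r fsbig1 ?addr0// => z [_ /eqP /negPf zE].
by rewrite matrix_unitE zE andbF mul0r.
Qed.

Definition is_diagonal f := forall x y, x != y -> f x y = 0.

Lemma mul_diagonalr f g u v : is_diagonal g -> (f * g) u v = f u v * g v v.
Proof.
move=> dg; rewrite incidenceME; have [uv|uv] := boolP (u <= v)%O; last first.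
  by rewrite [f u v]incidence_out// mul0r fsbig1// => z /andP[uz zv];
     rewrite (le_trans uz zv) in uv.
rewrite (fsbigD1 v) /=; first last.
- by rewrite uv lexx.
- by apply: sub_finite_set (finite_between u v) => z [].
by rewrite fsbig1 ?addr0// => z [_ /eqP zv]; rewrite dg// mulr0.
Qed.

Lemma mul_diagonall f g u v : is_diagonal g -> (g * f) u v = g u u * f u v.
Proof.
move=> dg; rewrite incidenceME; have [uv|uv] := boolP (u <= v)%O; last first.
  by rewrite [f u v]incidence_out// mulr0 fsbig1// => z /andP[uz zv];
     rewrite (le_trans uz zv) in uv.
rewrite (fsbigD1 u) /=; first last.
- by rewrite uv lexx.
- by apply: sub_finite_set (finite_between u v) => z [].
by rewrite fsbig1 ?addr0// => z [_ /eqP zv]; rewrite dg ?mul0r// eq_sym.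
Qed.

Lemma commutatorE f g : commutator f g = lie_bracket f g.
Proof. by rewrite [commutator]unlock. Qed.

Lemma commutator_unitr f x y u v : commutator f (E x y) u v =
  (if (x <= y)%O && (v == y) then f u x else 0)
  - (if (x <= y)%O && (u == x) then f y v else 0).
Proof.
rewrite commutatorE incidenceDE incidenceNE.
by rewrite mul_matrix_unitr mul_matrix_unitl.
Qed.

Lemma commutator_unitl f x y u v : commutator (E x y) f u v =
  (if (x <= y)%O && (u == x) then f y v else 0)
  - (if (x <= y)%O && (v == y) then f u x else 0).
Proof.
rewrite commutatorE incidenceDE incidenceNE.
by rewrite mul_matrix_unitl mul_matrix_unitr.
Qed.

Lemma commutatorZr c f g : commutator f (c *: g) = c *: commutator f g.
Proof.
rewrite !commutatorE /lie_bracket scalerBr.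
by rewrite -incidence_scalerAl -incidence_scalerAr.
Qed.

Lemma commutatorZl c f g : commutator (c *: f) g = c *: commutator f g.
Proof.
rewrite !commutatorE /lie_bracket scalerBr.
by rewrite -incidence_scalerAl -incidence_scalerAr.
Qed.

Lemma commutator_diagonalr f g u v :
  is_diagonal g -> commutator f g u v = f u v * (g v v - g u u).
Proof.
move=> dg; rewrite commutatorE incidenceDE incidenceNE.
by rewrite mul_diagonalr// mul_diagonall//; ring.
Qed.

Lemma commutator_diagonall f g u v :
  is_diagonal g -> commutator g f u v = f u v * (g u u - g v v).
Proof.
move=> dg; rewrite commutatorE incidenceDE incidenceNE.
by rewrite mul_diagonall// mul_diagonalr//; ring.
Qed.

(** Commutation with [E y y], read at [(x, y)], already forces [f x y = 0]. *)
Lemma central_diagonal f : is_central f -> is_diagonal f.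
Proof.
move=> cf x y xy; have := congr1 (fun h => h x y) (cf (E y y)).
by rewrite mul_matrix_unitr mul_matrix_unitl lexx eqxx (negPf xy).
Qed.

Lemma scalar_central f :
  is_diagonal f -> (forall x y, f x x = f y y) -> is_central f.
Proof.
move=> df ff g; apply: incidenceP => u v.
by rewrite mul_diagonall// mul_diagonalr// mulrC (ff u v).
Qed.

Lemma connected_const (T : Type) (h : X -> T) : connected_preorder X ->
  (forall x y, (x <= y)%O -> h x = h y) -> forall x y, h x = h y.
Proof.
move=> cX hh x y; have [s [+ <-]] := cX x y; elim: s x {y} => //= z s IHs x.
by move=> /andP[/orP[] /hh hxz /IHs]; rewrite hxz.
Qed.

Definition inner g f : incidence R X := lie_bracket f g.

Fact inner_linear g : linear (inner g).
Proof.
move=> c f h; rewrite /inner /lie_bracket mulrDl mulrDr opprD addrACA.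
by rewrite -incidence_scalerAl -incidence_scalerAr scalerBr.
Qed.

HB.instance Definition _ g :=
  GRing.isLinear.Build R (incidence R X) (incidence R X) *:%R (inner g)
    (inner_linear g).

Fact hadamard_supp (w : X -> X -> R) f :
  (fun x y => w x y * f x y) \in @incidence_supp R d X.
Proof. by apply/asboolP=> x y xy; rewrite incidence_out// mulr0. Qed.

Definition hadamard w f : incidence R X := Incidence (hadamard_supp w f).

Lemma hadamardE w f x y : hadamard w f x y = w x y * f x y.
Proof. by []. Qed.

Fact hadamard_linear w : linear (hadamard w).
Proof.
move=> c f h; apply: incidenceP => x y.
by rewrite !(incidenceDE, incidenceZE, hadamardE) mulrDr mulrCA.
Qed.

HB.instance Definition _ w :=
  GRing.isLinear.Build R (incidence R X) (incidence R X) *:%R (hadamard w)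
    (hadamard_linear w).

(** Additivity of [w] splits the factor [w x y] in each summand [f x z * g z y] of the
    convolution. *)
Lemma hadamard_derivation w :
  (forall x y z, (x <= y)%O -> (y <= z)%O -> w x z = w x y + w y z) ->
  is_derivation (hadamard w).
Proof.
move=> wD f g; apply: incidenceP => x y.
rewrite incidenceDE hadamardE !incidenceME.
rewrite !fsbig_finite; try exact: finite_between.
rewrite mulr_sumr -big_split; apply: eq_big_seq => z /=.
rewrite in_fset_set ?inE; last exact: finite_between.
by move=> /andP[xz zy]; rewrite (wD x z y)//; ring.
Qed.

End IncidenceEntries.

(** * Inner correction making the images of the idempotents diagonal *)

Section InnerCorrection.
Variables (R : comPzRingType) (d : Order.disp_t).
Variable X : locallyFinitePreorderType d.
Variable L : {linear incidence R X -> incidence R X}.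
Hypothesis LT : is_lie_triple_derivation L.
Notation E := (@matrix_unit R d X).

Lemma idempotents_central x y : x != y ->
  is_central (commutator (L (E x x)) (E y y) + commutator (E x x) (L (E y y))).
Proof.
move=> xy f; have exy : commutator (E x x) (E y y) = 0.
  rewrite commutatorE /lie_bracket; apply: incidenceP => u v.
  rewrite incidenceDE incidenceNE !mul_matrix_unitr !matrix_unitE !lexx /=.
  rewrite (negPf xy) [y == x]eq_sym (negPf xy) !andbF /= !if_same.
  by rewrite subrr.
have c0 g : lie_bracket (0 : incidence R X) g = 0.
  by rewrite /lie_bracket mul0r mulr0 subrr.
have := LT (E x x) (E y y) f.
rewrite -(commutatorE (E x x) (E y y)) exy !c0 raddf0 addr0 -lie_bracketDl.
by move=> h; rewrite !commutatorE; apply/subr0_eq/esym.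
Qed.

(** Support of the element defining the inner correction: its row [x] is the off-diagonal part of
    row [x] of [L (E x x)]. *)
Fact idempotent_columns_supp :
  (fun x y => if x == y then 0 else L (E x x) x y) \in @incidence_supp R d X.
Proof.
by apply/asboolP=> x y xy; case: eqP => // _; rewrite incidence_out.
Qed.

Lemma diagonalizing_inner :
  exists g : incidence R X, forall x, is_diagonal ((L \- inner g) (E x x)).
Proof.
exists (Incidence idempotent_columns_supp) => z x y xy.
have off u v a b : u != v -> a != b ->
    (commutator (L (E u u)) (E v v) + commutator (E u u) (L (E v v))) a b = 0.
  by move=> uv ab; apply: central_diagonal ab; exact: idempotents_central.
have -> g : (L \- inner g) (E z z) x y
    = L (E z z) x y - commutator (E z z) g x y by rewrite commutatorE.
rewrite commutator_unitl lexx /=.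
have [xz|xz] := eqVneq x z; have [yz|yz] := eqVneq y z.
- by rewrite xz yz eqxx in xy.
- by rewrite xz subr0 subrr.
(* Here [y = z], and entry [(x, y)] of the central sum is [L (E x x) x y + L (E y y) x y]. *)
- have := off x y x y xy xy.
  rewrite incidenceDE commutator_unitr commutator_unitl !lexx !eqxx /=.
  by rewrite -yz [y == x]eq_sym (negPf xy) !subr0 sub0r opprK addrC.
(* For the pair [z], [y], entry [(x, y)] of the central sum reduces to [L (E z z) x y]. *)
- have yx : y != x by rewrite eq_sym.
  have zy : z != y by rewrite eq_sym.
  have := off z y x y zy xy.
  rewrite incidenceDE commutator_unitr commutator_unitl !lexx !eqxx.
  by rewrite (negPf xy) (negPf xz) [y == z]eq_sym (negPf zy) /= !subr0 addr0.
Qed.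

End InnerCorrection.

(** * Off-diagonal weights and diagonal values *)

Section DiagonalOnIdempotents.
Variables (R : comPzRingType) (d : Order.disp_t).
Variable X : locallyFinitePreorderType d.
Variable L : {linear incidence R X -> incidence R X}.
Hypothesis R2 : two_torsion_free R.
Hypothesis LT : is_lie_triple_derivation L.
Notation E := (@matrix_unit R d X).
Hypothesis LD : forall x, is_diagonal (L (E x x)).
Implicit Types (f g h : incidence R X) (x y z u v : X).

Let entries := (@commutator_unitr R d X, @commutator_unitl R d X,
  fun f x u v => commutator_diagonalr f u v (LD x),
  fun f x u v => commutator_diagonall f u v (LD x),
  @matrix_unitE R d X, @lexx).

(** The equation lets [L] be applied to a simplified form [h] of the bracket. *)
Lemma lie_triple_entry a b c h u v : commutator (commutator a b) c = h ->
  L h u v = commutator (commutator (L a) b) c u v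
    + commutator (commutator a (L b)) c u v
    + commutator (commutator a b) (L c) u v.
Proof. by move=> <-; rewrite !commutatorE LT !incidenceDE. Qed.

Lemma commutator_idempotents f x y : x != y ->
  commutator (commutator (E x x) f) (E y y) = f x y *: E x y + f y x *: E y x.
Proof.
move=> xy; apply: incidenceP => u v.
have yx : (y == x) = false by rewrite eq_sym (negPf xy).
rewrite incidenceDE !incidenceZE !entries /=.
(* The support of [f] absorbs the order test built into [matrix_unit]. *)
have fE a b : f a b * (a <= b)%O%:R = f a b.
  by have [ab|ab] := boolP (a <= b)%O; rewrite ?mulr1// incidence_out ?mul0r.
rewrite -!andbA; case: (u == x); case: (v == y); case: (u == y); case: (v == x);
  rewrite ?yx /= ?andbT ?andbF ?fE /=; ring.
Qed.

Lemma commutator_units x y z : (x <= y)%O -> (y <= z)%O -> x != z ->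
  commutator (E x y) (E y z) = E x z.
Proof.
move=> xy yz xz; apply: incidenceP => u v.
rewrite !entries xy yz (le_trans xy yz) eqxx andbT /=.
rewrite [z == x]eq_sym (negPf xz) /=.
by case: (u == x); case: (v == z); rewrite /= ?if_same ?eqxx; ring.
Qed.

(** This removes the [E y x] term of [commutator_idempotents] from entry [(x, y)]. It follows from
    [[[E y x, E x x], E y x] = 0] and 2-torsion freeness. *)
Lemma matrix_unit_transpose x y : x != y -> L (E y x) x y = 0.
Proof.
move=> xy; have yx : y != x by rewrite eq_sym.
have [yx_le|nyx] := boolP (y <= x)%O; last first.
  have -> : E y x = 0.
    by apply: incidenceP => u v; rewrite matrix_unitE (negPf nyx).
  by rewrite raddf0.
have eyx : commutator (E y x) (E x x) = E y x by rewrite commutator_units.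
have h0 : commutator (commutator (E y x) (E x x)) (E y x) = 0.
  by rewrite eyx commutatorE /lie_bracket subrr.
(* Both surviving terms of the identity have (x, x) entry [- L (E y x) x y]. *)
have := lie_triple_entry x x h0.
rewrite eyx raddf0 incidence0E !entries /= yx_le (negPf xy) (negPf yx) !eqxx /=.
move=> h; apply: R2; rewrite mulr2n -[RHS]oppr0 h; ring.
Qed.

(** Entry [(x, y)] of [L] applied to [commutator_idempotents]. The last summand is an error term,
    shown to vanish in [off_diagonal]. *)
Lemma off_diagonal_sum f x y : x != y ->
  f x y * L (E x y) x y
    = L f x y + f x y * (L (E x x) x x - L (E x x) y y
                         + (L (E y y) y y - L (E y y) x x)).
Proof.
move=> xy; have yx : (y == x) = false by rewrite eq_sym (negPf xy).
have := lie_triple_entry x y (commutator_idempotents f xy).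
rewrite !linearD !linearZ_LR !incidenceDE !incidenceZE !entries /=.
rewrite matrix_unit_transpose// (negPf xy) yx !eqxx /= mulr0 addr0 => ->; ring.
Qed.

(** For [x <= y], the choice [f := E x y] in [off_diagonal_sum] shows that the error factor is
    zero. *)
Lemma off_diagonal f x y : x != y -> L f x y = L (E x y) x y * f x y.
Proof.
move=> xy; have [xy_le|nxy] := boolP (x <= y)%O; last first.
  by rewrite !incidence_out ?mulr0.
have := off_diagonal_sum (E x y) xy.
rewrite matrix_unitE xy_le !eqxx !mul1r -[LHS]addr0 => /addrI/esym cxy.
by rewrite mulrC (off_diagonal_sum _ xy) cxy mulr0 addr0.
Qed.

(** Since [E x y = [[E x y, E y y], E y y]], its image is a sum of brackets with the diagonal
    elements [E y y] and [L (E y y)], which have zero diagonal. [off_diagonal] gives the other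
    entries. *)
Lemma scale_units x y : (x <= y)%O -> x != y ->
  L (E x y) = L (E x y) x y *: E x y.
Proof.
move=> xy_le xy; have yx : y != x by rewrite eq_sym.
have exy : commutator (E x y) (E y y) = E x y by rewrite commutator_units.
apply: incidenceP => u v; rewrite incidenceZE matrix_unitE xy_le.
have [<-{v}|uv] := eqVneq u v.
  have := lie_triple_entry u u (congr1 (fun h => commutator h (E y y)) exy).
  rewrite exy !entries xy_le !eqxx /=.
  have [->|uy] := eqVneq u y; last have [->|ux] := eqVneq u x.
  - by rewrite (negPf yx) /= (LD _ yx) !(subrr, addr0, mulr0).
  - by rewrite /= (LD _ yx) !(subrr, addr0, mulr0).
  - by rewrite /= !(subrr, addr0, mulr0).
rewrite off_diagonal// matrix_unitE xy_le; case: (eqVneq u x) => [->|_] /=.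
  by case: (eqVneq v y) => [->|_] //=; rewrite !mulr0.
by rewrite !mulr0.
Qed.

(** Entry [(x, y)] of the image of [[[f, E x y], E y y]]. *)
Lemma diagonal_sum f x y : (x <= y)%O -> x != y ->
  L f x x - L f y y + (f x x - f y y) * (L (E y y) y y - L (E y y) x x) = 0.
Proof.
move=> xy_le xy; have yx : (y == x) = false by rewrite eq_sym (negPf xy).
have := lie_triple_entry x y
  (erefl (commutator (commutator f (E x y)) (E y y))).
rewrite (off_diagonal _ xy) (scale_units xy_le xy).
rewrite !(commutatorZr, commutatorZl).
rewrite !incidenceZE !entries xy_le !eqxx yx (negPf xy) /= => h.
(* This is the left side of [h]; it reappears on the right through [L (E x y)] and cancels. *)
apply: (addrI (L (E x y) x y * (f x x - f y y))).
by apply: etrans (etrans (esym h) _); ring.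
Qed.

(** With [f := E y y], [diagonal_sum] becomes twice the difference of the two sides. *)
Lemma idempotent_entries x y : (x <= y)%O -> L (E y y) x x = L (E y y) y y.
Proof.
have [->//|xy xy_le] := eqVneq x y.
apply/eqP; rewrite -subr_eq0; apply/eqP/R2; rewrite mulr2n.
rewrite -[RHS](diagonal_sum (E y y) xy_le xy).
by rewrite !matrix_unitE lexx eqxx (negPf xy) /=; ring.
Qed.

Lemma diagonal_le f x y : (x <= y)%O -> L f x x = L f y y.
Proof.
have [->//|xy xy_le] := eqVneq x y.
have /eqP := diagonal_sum f xy_le xy.
by rewrite (idempotent_entries xy_le) subrr mulr0 addr0 subr_eq0 => /eqP.
Qed.

(** * Constant diagonals and additivity of the weights *)

Section Connected.
Hypothesis cX : connected_preorder X.

Lemma diagonal_const f x y : L f x x = L f y y.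
Proof.
by apply: (connected_const (h := fun z => L f z z)) => // u v; exact: diagonal_le.
Qed.

(** Additivity forces the value 0 on the diagonal; [L (E x x) x x] itself goes into the central
    part. *)
Definition weight x y : R := if x == y then 0 else L (E x y) x y.

Lemma L_weight x y : (x <= y)%O -> x != y -> L (E x y) = weight x y *: E x y.
Proof. by move=> xy_le xy; rewrite /weight (negPf xy) -scale_units. Qed.

Lemma commutator_image_idempotent f x : commutator f (L (E x x)) = 0.
Proof.
apply: incidenceP => u v.
by rewrite !entries (diagonal_const _ u v) subrr mulr0.
Qed.

Lemma weight_trans x y z : (x <= y)%O -> (y <= z)%O ->
  weight x z = weight x y + weight y z.
Proof.
move=> xy_le yz_le; have [<-|xy] := eqVneq x y.
  by rewrite /weight eqxx add0r.
have [<-|yz] := eqVneq y z; first by rewrite /weight [in RHS]eqxx addr0.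
(* In a pre-order [x <= y <= x] may hold with [x != y]. Then [[[E x y, E y x], E x y]] is twice
   [E x y], and its image gives [2 * (weight x y + weight y x) = 0]. *)
have [xz|xz] := eqVneq x z.
  rewrite -{}xz in yz_le yz *.
  have h : commutator (commutator (E x y) (E y x)) (E x y) = E x y *+ 2.
    apply: incidenceP => u v.
    rewrite mulr2n incidenceDE !entries xy_le yz_le !eqxx.
    rewrite (negPf xy) (negPf yz) /=.
    by case: (u == x); case: (v == y);
      rewrite /= ?eqxx ?(negPf xy) ?(negPf yz) ?if_same /=; ring.
  have := lie_triple_entry x y h.
  rewrite linearMn L_weight// (L_weight yz_le yz) !(commutatorZr, commutatorZl).
  rewrite h mulr2n !(incidenceDE, incidenceZE) matrix_unitE xy_le !eqxx /=.
  move=> h2.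
  rewrite [weight x x]/weight eqxx; apply/esym/R2.
  apply: (addrI (weight x y + weight x y)).
  by apply: etrans (etrans (esym h2) _); ring.
(* The outer bracket with [E z z] changes nothing, and [L (E z z)] commutes with everything, so only
   two terms survive. *)
have h : commutator (commutator (E x y) (E y z)) (E z z) = E x z.
  by rewrite !commutator_units// (le_trans xy_le yz_le).
have := lie_triple_entry x z h.
have xz_le := le_trans xy_le yz_le.
rewrite commutator_image_idempotent (L_weight xz_le)// (L_weight xy_le)//.
rewrite (L_weight yz_le)//.
rewrite !(commutatorZr, commutatorZl) h.
rewrite !incidenceZE !matrix_unitE xz_le !eqxx /=.
by rewrite !mulr1 addr0.
Qed.

End Connected.

End DiagonalOnIdempotents.

Theorem theorem3p6 (R : comPzRingType) (d : Order.disp_t)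
    (X : locallyFinitePreorderType d) :
  two_torsion_free R ->
  connected_preorder X ->
  forall L : {linear incidence R X -> incidence R X},
    is_lie_triple_derivation L ->
    exists D F : {linear incidence R X -> incidence R X},
      [/\ is_derivation D,
          forall f : incidence R X, is_central (F f)
        & forall f : incidence R X, L f = D f + F f].
Proof.
move=> R2 cX L LT.
have [g Lg] := diagonalizing_inner LT.
pose L' : {linear incidence R X -> incidence R X} := L \- inner g.
have L'T : is_lie_triple_derivation L'.
  apply: is_lie_triple_derivationB => //.
  exact/derivation_lie_triple/is_derivation_inner.
pose w := weight L'.
have w0 x : w x x = 0 by rewrite /w /weight eqxx.
have dw : is_derivation (hadamard w).
  by apply: hadamard_derivation => x y z; exact: weight_trans.
exists (inner g \+ hadamard w), (L' \- hadamard w); split.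
- exact: is_derivationD (is_derivation_inner g) dw.
- have FE f x y : (L' \- hadamard w) f x y = L' f x y - w x y * f x y by [].
  (* Off the diagonal the two terms cancel; on it [w x x = 0] leaves [L' f x x], which is constant
     by connectedness. *)
  move=> f; apply: scalar_central => [x y xy|x y]; rewrite !FE.
    by rewrite /w /weight (negPf xy) (off_diagonal R2 L'T Lg)// subrr.
  by rewrite !w0 !mul0r (diagonal_const R2 L'T Lg cX f x y).
- have LE f : L f = inner g f + L' f by rewrite addrC subrK.
  move=> f; rewrite LE.
  rewrite -[RHS]/(inner g f + hadamard w f + (L' f - hadamard w f)).
  by rewrite -[RHS]addrA; congr (_ + _); rewrite addrC subrK.
Qed.
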